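(* Let $G$ be a finite undirected graph (possibly with loops and multiple edges) with nonempty vertex set $V$ and edge set $E$, and let $b\in\mathbb{R}^V$ have all entries nonnegative. If $\mathcal{P}(G,b)$ is nonempty, then its dimension is $|\mathrm{supp}(\mathcal{P}(G,b))|-|V|+B$, where $B$ is the number of bipartite components of $\mathrm{gr}(\mathcal{P}(G,b))$.
   Context: $\delta_G(v)$ denotes the set of edges of $G$ incident with $v$; a loop at $v$ appears once in $\delta_G(v)$. $\mathcal{P}(G,b)=\{x\in\mathbb{R}^E \mid x_e\ge 0 \text{ for each } e\in E,\ \sum_{e\in\delta_G(v)}x_e=b_v \text{ for each } v\in V\}$ (a polytope; when $E=\emptyset$, $\mathbb{R}^\emptyset=\{0\}$, so it is $\{0\}$ if $b=0$ and $\emptyset$ otherwise). For $X\subset\mathcal{P}(G,b)$, $\mathrm{supp}(X)=\{e\in E\mid \text{there exists } x\in X \text{ with } x_e\neq 0\}$, and $\mathrm{gr}(X)$ is the spanning subgraph of $G$ (vertex set $V$) with edge set $\mathrm{supp}(X)$. A graph with loops is bipartite if and only if it has no odd-length cycle, where a vertex with a loop is a cycle of length 1 and two distinct parallel edges between two distinct vertices form a cycle of length 2; in particular an isolated vertex (with no loop) is a bipartite component. *)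

(* Defs.v *)
From HB Require Import structures.
From mathcomp Require Import all_boot all_order all_algebra.
From mathcomp Require Import boolp classical_sets reals.

Set Implicit Arguments.
Unset Strict Implicit.
Unset Printing Implicit Defensive.

Import Order.TTheory GRing.Theory Num.Theory.
Local Open Scope ring_scope.

(* A finite undirected multigraph on the vertex type V with edge type E; an   *)
(* edge is a loop when its set of ends is a singleton.                        *)
Record mgraph (V E : finType) := MGraph {
  ends : E -> {set V};
  ends_card : forall e, (0 < #|ends e| <= 2)%N
}.

Section Multigraphs.
Variables (V E : finType) (G : mgraph V E).

(* As a set of edges, so that a loop at v occurs once.                        *)
Definition delta (v : V) : {set E} := [set e | v \in ends G e]%SET.

Definition adjacent (u v : V) : bool :=
  [exists e, ends G e == [set u; v]%SET].

Definition components : {set {set V}} :=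
  equivalence_partition (connect adjacent) [set: V]%SET.

(* A closed sequence v_0 e_0 v_1 e_1 ... v_(n-1) e_(n-1) v_0, n > 0, with     *)
(* distinct vertices and distinct edges, is encoded as the list of the pairs  *)
(* (v_i, e_i); the ends of e_i are v_i and v_(i+1), with indices mod n. For   *)
(* n = 1 this is a loop, for n = 2 a pair of distinct parallel edges.         *)
Definition cycle_step (p q : V * E) : bool :=
  ends G p.2 == [set p.1; q.1]%SET.

Definition is_cycle (c : seq (V * E)) : bool :=
  [&& (0 < size c)%N, uniq (unzip1 c), uniq (unzip2 c) & cycle cycle_step c].

(* Bipartiteness of the subgraph induced by C: its cycles are the cycles of G *)
(* whose vertices all lie in C.                                               *)
Definition bipartite_on (C : {set V}) : Prop :=
  forall c, is_cycle c -> {subset unzip1 c <= C} -> ~~ odd (size c).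

Definition bipartite_components : {set {set V}} :=
  [set C in components | `[< bipartite_on C >]]%SET.

Definition spanning_subgraph (F : {set E}) : mgraph V {e : E | e \in F} :=
  @MGraph V {e : E | e \in F} (fun e => ends G (val e))
    (fun e => ends_card G (val e)).

End Multigraphs.

Section AffineDimension.
Variables (R : realType) (vT : vectType R).

Definition affinely_independent k (p : 'I_k -> vT) : Prop :=
  forall a : 'I_k -> R,
    \sum_i a i = 0 -> \sum_i a i *: p i = 0 -> forall i, a i = 0.

Lemma affinely_independent_leq k (p : 'I_k -> vT) :
  affinely_independent p -> (k <= (\dim {: vT}).+1)%N.
Proof.
move=> p_ind; pose q := [tuple (p i, 1 : R^o) | i < k].
have q_free : free q.
  apply/freeP => a a0 i; apply: p_ind.
  - transitivity (\sum_(j < k) a j *: q`_j).2; last by rewrite a0.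
    rewrite (raddf_sum (@snd vT R^o)).
    by apply: eq_bigr => j _; rewrite -tnth_nth tnth_mktuple /= /GRing.scale /= mulr1.
  - transitivity (\sum_(j < k) a j *: q`_j).1; last by rewrite a0.
    rewrite (raddf_sum (@fst vT R^o)).
    by apply: eq_bigr => j _; rewrite -tnth_nth tnth_mktuple.
have := dimvS (subvf <<q>>%VS).
by rewrite (eqP q_free) size_tuple !dimvf /dim /= addn1.
Qed.

(* The dimension of X is one less than the maximal number of affinely         *)
(* independent points of X, hence -1 when X is empty. The bound on k is       *)
(* harmless by affinely_independent_leq.                                      *)
Definition affine_dim (X : set vT) : int :=
  (\max_(k < (\dim {: vT}).+2 |
      `[< exists p : 'I_k -> vT, affinely_independent p /\ forall i, X (p i) >])
    k)%N%:Z - 1.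

End AffineDimension.

Section EdgePolytope.
Variables (R : realType) (V E : finType) (G : mgraph V E).

(* R^E; the regular module R^o provides the vector space structure.           *)
Notation RE := {ffun E -> R^o}.

Definition edge_polytope (b : V -> R) : set RE :=
  [set x : RE | (forall e : E, 0 <= (x e : R)) /\
     (forall v : V, \sum_(e in delta G v) (x e : R) = b v)]%classic.

Definition supp (X : set RE) : {set E} :=
  [set e | `[< exists2 x : RE, X x & x e <> 0 >]]%SET.

Definition gr (X : set RE) : mgraph V {e : E | e \in supp X} :=
  spanning_subgraph G (supp X).

End EdgePolytope.

(* Main.v *)
(* Averaging points of the polytope that witness each edge of its support S   *)
(* gives a point x0 that is positive on S. Every vector supported on S in the *)
(* kernel of the vertex-edge incidence matrix A of gr is then a feasible      *)
(* direction at x0, so the dimension is that of this kernel, |S| - rank A.    *)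
(* The left kernel of A consists of the vertex functions that change sign     *)
(* along each edge; such a function is determined by its value at one root    *)
(* per component, which can be chosen freely in a bipartite component and     *)
(* must be 0 in any other. Hence rank A = |V| - B.                            *)
Require Import Defs.
From HB Require Import structures.
From mathcomp Require Import all_boot all_order all_algebra.
From mathcomp Require Import boolp classical_sets reals.

Set Implicit Arguments.
Unset Strict Implicit.
Unset Printing Implicit Defensive.

Import Order.TTheory GRing.Theory Num.Theory.
Local Open Scope ring_scope.

(** The dimension is the nullity of the incidence matrix A of gr. By rank-nullity, applied to A and
    to its transpose, it is |S| - |V| plus the dimension of the left kernel of A, which is B. The
    first fact is [edge_polytope_dim]: [edge_polytope_interior] supplies a point positive on S, and
    [edge_polytope_dir] moves from it along any kernel vector. The second is [rank_ker_incidence].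
    As bipartite means without odd cycles, its link with signs passes through the bipartite double
    cover: in a bipartite component the two lifts of a vertex are not connected there, since a walk
    between them projects to an odd closed walk, which yields an odd cycle
    ([odd_closed_walk_cycle]). *)

Lemma not_uniq_map_split (T T' : eqType) (f : T -> T') (s : seq T) :
  ~~ uniq (map f s) ->
  exists p x p1 y p2, s = p ++ x :: p1 ++ y :: p2 /\ f x = f y.
Proof.
elim: s => //= x s IHs; rewrite negb_and negbK.
case: (boolP (f x \in map f s)) => [/mapP[y ys fxy] _|_ /= /IHs].
  by case/splitPr: ys => p1 p2; exists [::], x, p1, y, p2.
by move=> [p [x' [p1 [y [p2 [-> fxy]]]]]]; exists (x :: p), x', p1, y, p2.
Qed.

(** * Odd closed walks and the bipartite double cover *)

Section OddCycles.
Variables (V E : finType) (G : mgraph V E).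

Lemma ends_set2 e : exists u v, ends G e = [set u; v]%SET.
Proof.
have := ends_card G e.
have [/cards1P[u ->] _|e1] := boolP (#|ends G e| == 1%N).
  by exists u, u; rewrite finset.setUid.
rewrite leq_eqVlt eq_sym (negPf e1) => /= e2.
suff /cards2P[u [v [_ ->]]] : #|ends G e| == 2%N by exists u, v.
by rewrite eqn_leq andbC.
Qed.

Lemma adjacent_sym : symmetric (adjacent G).
Proof. by move=> u v; apply: eq_existsb => e; rewrite finset.setUC. Qed.

Lemma cycle_step_adjacent p q : cycle_step G p q -> adjacent G p.1 q.1.
Proof. by move=> pq; apply/existsP; exists p.2. Qed.

Lemma eq_cycle_step p q q' : q.1 = q'.1 -> cycle_step G p q = cycle_step G p q'.
Proof. by rewrite /cycle_step => ->. Qed.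

Lemma walk_connect x c :
  path (cycle_step G) x c ->
  {in unzip1 (x :: c), forall v, connect (adjacent G) x.1 v}.
Proof.
elim: c x => [x _ v|y c IHc x /= /andP[xy yc] v].
  by rewrite inE => /eqP ->; apply: connect0.
rewrite inE => /predU1P[-> | vc]; first exact: connect0.
apply: connect_trans (IHc y yc v vc).
exact/connect1/cycle_step_adjacent.
Qed.

(** A step depends on its target only through the vertex, so a return to [y] serves equally as a
    return to [x]. *)
Lemma closed_walk_split x p1 y p2 : x.1 = y.1 ->
  cycle (cycle_step G) (x :: p1 ++ y :: p2) =
  cycle (cycle_step G) (x :: p1) && cycle (cycle_step G) (y :: p2).
Proof.
move=> xy; rewrite /= rcons_cat cat_path /= !rcons_path -!(eq_cycle_step _ xy).
by rewrite -andbA.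
Qed.

(* If an edge is repeated in an odd closed walk with distinct vertices, its   *)
(* two traversals are in opposite directions and hence exhaust the walk,      *)
(* which then has length 2.                                                   *)
Lemma odd_closed_walk_uniq c :
  cycle (cycle_step G) c -> odd (size c) -> uniq (unzip1 c) -> uniq (unzip2 c).
Proof.
move=> cc c_odd c_uniq; apply: contraT => /not_uniq_map_split.
move=> [p [x [p1 [y [p2 [cE xy]]]]]].
have rotE : rot (size p) c = x :: p1 ++ y :: p2 ++ p.
  by rewrite cE rot_size_cat /= -catA.
move: cc c_odd c_uniq.
rewrite -(rot_cycle (size p)) -(size_rot (size p) c) -(rot_uniq (size p)) -map_rot.
rewrite rotE; move: (p2 ++ p) => q.
(* If the two traversals are consecutive, the second leads back to the vertex of [x], which leaves
   only the even length 2. Otherwise the vertex of [y] would be a third end of the edge. *)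
case: p1 {cE rotE} => [|z p1] /=.
  case: q => [|t q] //= /and3P[xy1 yt _] _; rewrite !inE !negb_or.
  move=> /andP[/and3P[x_y x_t _] _]; move: yt; rewrite /cycle_step -xy (eqP xy1).
  by move/eqP/setP/(_ x.1); rewrite !inE eqxx (negPf x_y) (negPf x_t).
move=> /andP[xz]; rewrite rcons_cat cat_path /= => /and3P[_ _ yq] _.
rewrite !map_cat !inE !mem_cat !inE !negb_or -!andbA.
move=> /and5P[x_z x_p1 x_y x_q /and4P[z_p1 z_y _ _]].
have : y.1 \in ends G y.2.
  by case: q yq {x_q} => [|t q] /= /andP[/eqP -> _]; rewrite !inE eqxx.
by rewrite -xy (eqP xz) !inE eq_sym (negPf x_y) eq_sym (negPf z_y).
Qed.

(** By induction on the length: at a repeated vertex the walk splits into two shorter closed walks,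
    one of them odd. Without a repeated vertex it is already a cycle by [odd_closed_walk_uniq]. *)
Lemma odd_closed_walk_cycle c :
  cycle (cycle_step G) c -> odd (size c) ->
  exists c', [/\ is_cycle G c', odd (size c') & {subset unzip1 c' <= unzip1 c}].
Proof.
elim/ltn_ind: (size c) {-2}c (erefl (size c)) => {c} n IHn c cn cc c_odd.
have [c_uniq|] := boolP (uniq (unzip1 c)).
  exists c; split=> //; rewrite /is_cycle c_uniq odd_closed_walk_uniq // cc.
  by case: (c) c_odd.
move/not_uniq_map_split => [p [x [p1 [y [p2 [cE xy]]]]]].
have cR : perm_eq c (x :: p1 ++ y :: p2 ++ p) by rewrite cE perm_catC /= -catA.
have rotE : rot (size p) c = x :: p1 ++ y :: p2 ++ p.
  by rewrite cE rot_size_cat /= -catA.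
move: cc; rewrite -(rot_cycle (size p)) rotE closed_walk_split //.
move/andP=> [cc1 cc2]; have szc := perm_size cR.
rewrite /= size_cat /= in szc; rewrite szc in c_odd.
have sub c' : {subset c' <= x :: p1 ++ y :: p2 ++ p} ->
    {subset unzip1 c' <= unzip1 c}.
  by move=> c'S _ /mapP[z /c'S zc ->]; rewrite map_f // (perm_mem cR).
have [p1_odd|p1_even] := boolP (odd (size (x :: p1))).
  have [|c' [c'_cycle c'_odd c'S]] := IHn _ _ (x :: p1) erefl cc1 p1_odd.
    by rewrite -cn szc /= addnS !ltnS leq_addr.
  exists c'; split=> // v /c'S; apply: sub => z.
  by rewrite !inE mem_cat => /orP[->|->]; rewrite ?orbT.
have [||c' [c'_cycle c'_odd c'S]] := IHn _ _ (y :: p2 ++ p) erefl cc2.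
- by rewrite -cn szc /= !ltnS leq_addl.
- by move: c_odd p1_even; rewrite /= oddD /=; case: odd; case: odd.
exists c'; split=> // v /c'S; apply: sub => z.
by rewrite !(inE, mem_cat) => ->; rewrite !orbT.
Qed.

(* Adjacency in the bipartite double cover. *)
Definition signed_adjacent (p q : V * bool) : bool :=
  adjacent G p.1 q.1 && (q.2 == ~~ p.2).

Lemma signed_adjacent_sym : symmetric signed_adjacent.
Proof.
by move=> [u s] [v t]; rewrite /signed_adjacent /= adjacent_sym; case: s t => [] [].
Qed.

(** A walk in the double cover projects to [G], and each step flips the sign, whence the parity. The
    edge stored in the last pair is not traversed, so [q] may carry any edge. *)
Lemma signed_walk u s p v t : path signed_adjacent (u, s) p ->
  last (u, s) p = (v, t) -> forall q : V * E, q.1 = v ->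
  exists x c, [/\ x.1 = u, path (cycle_step G) x c, last x c = q
    & odd (size c) = s (+) t].
Proof.
elim: p u s => [|[w s'] p IHp] u s /=.
  by move=> _ [-> ->] q qv; exists q, [::]; rewrite addbb.
case/andP=> /andP[/= /existsP[e euw] /eqP ->] wp wv q qv.
have [x [c [xw xc cq c_odd]]] := IHp _ _ wp wv q qv.
exists (u, e), (x :: c); split=> //=; last by rewrite c_odd -addNb negbK.
by rewrite xc andbT /cycle_step /= xw.
Qed.

Lemma bipartite_on_unreachable r :
  bipartite_on G [set v | connect (adjacent G) r v]%SET ->
  ~~ connect signed_adjacent (r, true) (r, false).
Proof.
move=> bip; apply/negP => /connectP[[|[w s] p]] // wp /esym pr.
(* The first step provides some edge to complete the final pair. *)
have [/= /andP[/existsP[e _] _] _] := andP wp.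
have [x [c [xr xc cq c_odd]]] := signed_walk wp pr (erefl (r, e).1).
case/lastP: c c_odd xc cq => // c q; rewrite size_rcons last_rcons => c_odd.
(* The final pair has the same vertex as [x]; replacing it by [x] closes the walk. *)
have rx : (r, e).1 = x.1 by rewrite xr.
move=> /[swap] -> {q}; rewrite rcons_path (eq_cycle_step _ rx).
rewrite -rcons_path => xc.
have [c' [c'_cycle c'_odd c'S]] := odd_closed_walk_cycle (xc : cycle _ (x :: c)) c_odd.
have : {subset unzip1 c' <= [set v | connect (adjacent G) r v]%SET}.
  move=> v /c'S vc; rewrite inE -xr; apply: (walk_connect _ vc).
  by move: xc; rewrite rcons_path => /andP[].
by move/(bip _ c'_cycle); rewrite c'_odd.
Qed.

End OddCycles.

(** * The left kernel of the incidence matrix *)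

Section IncidenceRank.
Variables (R : realFieldType) (V E : finType) (G : mgraph V E).

Definition incidence : 'M[R]_(#|V|, #|E|) :=
  \matrix_(i, j) (enum_val i \in ends G (enum_val j))%:R.

Definition alternating (z : V -> R) : Prop :=
  forall u v, adjacent G u v -> z u + z v = 0.

Lemma mul_row_incidence (w : 'rV[R]_#|V|) j :
  (w *m incidence) 0 j = \sum_(v in ends G (enum_val j)) w 0 (enum_rank v).
Proof.
rewrite mxE [RHS]big_mkcond (reindex _ (onW_bij _ (@enum_rank_bij V))) /=.
by apply: eq_bigr => v _; rewrite mxE enum_rankK mulr_natr mulrb.
Qed.

(** A loop at u contributes z u = 0 on the left and 2 z u = 0 on the right; these agree in
    characteristic 0. *)
Lemma incidence_kerP (w : 'rV[R]_#|V|) :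
  w *m incidence = 0 <-> alternating (fun v => w 0 (enum_rank v)).
Proof.
split=> [w0 u v /existsP[e /eqP euv]|w_alt].
  move/matrixP/(_ 0 (enum_rank e)): w0.
  rewrite mul_row_incidence enum_rankK mxE euv.
  have [-> |uv] := eqVneq u v; last by rewrite big_setU1 ?inE //= big_set1.
  by rewrite finset.setUid big_set1 => ->; rewrite addr0.
apply/rowP => j; rewrite mul_row_incidence mxE.
have [u [v euv]] := ends_set2 G (enum_val j).
have /w_alt : adjacent G u v by apply/existsP; exists (enum_val j); apply/eqP.
rewrite euv; have [-> |uv] := eqVneq u v; last by rewrite big_setU1 ?inE //= big_set1.
by rewrite finset.setUid big_set1 -mulr2n => /eqP; rewrite mulrn_eq0 => /eqP.
Qed.

(** Twisted by the sign, an alternating function lifts to one that is constant along the edges of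
    the double cover. *)
Lemma signed_connect_alternating z p q : alternating z ->
  connect (signed_adjacent G) p q -> (-1) ^+ q.2 * z q.1 = (-1) ^+ p.2 * z p.1.
Proof.
move=> z_alt /connectP[c pc ->] {q}; elim: c p pc => //= q c IHc p /andP[pq qc].
rewrite IHc //; case/andP: pq => /z_alt /eqP; rewrite addr_eq0 => /eqP -> /eqP ->.
by rewrite signrN mulNr mulrN.
Qed.

Lemma connect_signed_connect u v : connect (adjacent G) u v ->
  exists s, connect (signed_adjacent G) (u, true) (v, s).
Proof.
case/connectP=> c + ->; elim/last_ind: c => [_|c w IHc].
  by exists true; apply: connect0.
rewrite rcons_path last_rcons => /andP[/IHc[s us] cw].
exists (~~ s); apply: connect_trans us _; apply: connect1.
by rewrite /signed_adjacent /= cw eqxx.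
Qed.

Lemma signed_connect_connect p q :
  connect (signed_adjacent G) p q -> connect (adjacent G) p.1 q.1.
Proof.
case/connectP=> c + ->; elim: c p => [p _|q' c IHc p /= /andP[/andP[pq _] qc]].
  exact: connect0.
exact: connect_trans (connect1 pq) (IHc _ qc).
Qed.

(* For r in a bipartite component, the 2-colouring by signs of the component; *)
(* in a component that is not bipartite both terms are 1 and cancel.          *)
Definition reach_sign (r v : V) : R :=
  (connect (signed_adjacent G) (r, true) (v, true))%:R
  - (connect (signed_adjacent G) (r, true) (v, false))%:R.

Lemma reach_sign_alternating r : alternating (reach_sign r).
Proof.
move=> u v uv; have sym := sym_connect_sym (signed_adjacent_sym G).
have uvE s : connect (signed_adjacent G) (r, true) (u, s) =
             connect (signed_adjacent G) (r, true) (v, ~~ s).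
  by apply: (same_connect_r sym); apply: connect1; rewrite /signed_adjacent /= uv eqxx.
by rewrite /reach_sign !uvE /= -[X in X + _]opprB addNr.
Qed.

Lemma reach_sign_unconnected r v : ~~ connect (adjacent G) r v -> reach_sign r v = 0.
Proof.
move=> rv; have N s : connect (signed_adjacent G) (r, true) (v, s) = false.
  by apply: contraNF rv => /signed_connect_connect.
by rewrite /reach_sign !N subrr.
Qed.

(** If only one lift of [v] is reached, its sign relates z v to z r. If both are, then z v equals z
    r and - z r, so it vanishes, as does [reach_sign r v]. *)
Lemma alternating_reach_sign z r v : alternating z -> connect (adjacent G) r v ->
  z v = z r * reach_sign r v.
Proof.
move=> z_alt /connect_signed_connect[s]; rewrite /reach_sign.
have T := signed_connect_alternating z_alt (p := (r, true)) (q := (v, true)).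
have F := signed_connect_alternating z_alt (p := (r, true)) (q := (v, false)).
have Vr : connect (signed_adjacent G) (r, true) (v, true) -> z v = z r.
  by move/T; rewrite /= !mulN1r => /oppr_inj.
have Vn : connect (signed_adjacent G) (r, true) (v, false) -> z v = - z r.
  by move/F; rewrite /= mul1r mulN1r.
case: s => [rT|rF].
  rewrite rT; case: connect Vn => [/(_ isT) Vn|_]; last by rewrite subr0 mulr1 Vr.
  by rewrite subrr mulr0; apply/eqP; rewrite -eqNr {1}Vn opprK Vr.
rewrite rF; case: connect Vr => [/(_ isT) Vr|_]; last by rewrite sub0r mulrN1 Vn.
by rewrite subrr mulr0; apply/eqP; rewrite -eqNr {1}Vn // opprK Vr.
Qed.

Lemma walk_alternating z x c : alternating z -> path (cycle_step G) x c ->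
  z (last x c).1 = (-1) ^+ size c * z x.1.
Proof.
move=> z_alt; elim: c x => [|y c IHc] x /=; first by rewrite mul1r.
case/andP=> /cycle_step_adjacent/z_alt/eqP; rewrite addr_eq0 => /eqP -> /IHc ->.
by rewrite exprS mulN1r mulrNN.
Qed.

(** Going around an odd cycle gives z x = - z x, and a zero at one vertex spreads over its
    component. *)
Lemma alternating_not_bipartite z r : alternating z ->
  ~ bipartite_on G [set v | connect (adjacent G) r v]%SET -> z r = 0.
Proof.
move=> z_alt /existsNP[[|x c] /not_implyP[/and4P[//_ _ _ xc] /not_implyP[cC]]].
move/negP; rewrite negbK => c_odd.
have zx : z x.1 = 0.
  have := walk_alternating z_alt xc; rewrite last_rcons size_rcons -signr_odd c_odd.
  by rewrite mulN1r => /esym/eqP; rewrite eqNr => /eqP.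
have : x.1 \in [set v | connect (adjacent G) r v]%SET by rewrite cC //= inE eqxx.
rewrite inE (sym_connect_sym (adjacent_sym G)) => xr.
by rewrite (alternating_reach_sign z_alt xr) zx mul0r.
Qed.

Lemma reach_sign_root r :
  bipartite_on G [set v | connect (adjacent G) r v]%SET -> reach_sign r r = 1.
Proof.
by move/bipartite_on_unreachable/negPf; rewrite /reach_sign connect0 => ->; rewrite subr0.
Qed.

Lemma componentP (C : {set V}) : reflect
  (exists r, C = [set v | connect (adjacent G) r v]%SET) (C \in components G).
Proof.
apply: (iffP imsetP) => [[r _ ->]|[r ->]]; exists r => //;
  by apply/setP => v; rewrite !inE.
Qed.

Lemma bipartite_components_root (i : 'I_#|bipartite_components G|) :
  exists r, enum_val i = [set v | connect (adjacent G) r v]%SET.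
Proof. by have := enum_valP i; rewrite inE => /andP[/componentP]. Qed.

(** With one root chosen in each bipartite component, the functions [reach_sign] of the roots form a
    basis of the left kernel. *)
Lemma rank_ker_incidence : \rank (kermx incidence) = #|bipartite_components G|.
Proof.
have [r rP] := choice bipartite_components_root.
have r_bip i : bipartite_on G [set v | connect (adjacent G) (r i) v]%SET.
  by have := enum_valP i; rewrite inE rP => /andP[_ /asboolP].
have sym := sym_connect_sym (adjacent_sym G).
have r_inj i j : connect (adjacent G) (r i) (r j) -> i = j.
  move=> ij; apply: enum_val_inj; rewrite !rP; apply/setP => v; rewrite !inE.
  exact: same_connect.
have signE i j : reach_sign (r i) (r j) = (i == j)%:R.
  have [-> |ij] := eqVneq i j; first exact: reach_sign_root.
  by apply: reach_sign_unconnected; apply: contra ij => /r_inj ->.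
pose Z : 'M[R]_(_, #|V|) := \matrix_(i, j) reach_sign (r i) (enum_val j).
(* Right multiplication by [Q] reads off the values at the roots; as a right inverse of [Z] it shows
   that the rows of [Z] are independent. *)
pose Q : 'M[R]_(#|V|, _) := \matrix_(j, i) (j == enum_rank (r i))%:R.
have mulQ m (W : 'M[R]_(m, #|V|)) i j : (W *m Q) i j = W i (enum_rank (r j)).
  rewrite mxE (bigD1 (enum_rank (r j))) //= mxE eqxx mulr1 big1 ?addr0 // => k kj.
  by rewrite mxE (negPf kj) mulr0.
have ZQ : Z *m Q = 1%:M.
  by apply/matrixP => i j; rewrite mulQ !mxE enum_rankK signE.
have ZA : Z *m incidence = 0.
  apply/row_matrixP => i; rewrite row_mul row0; apply/incidence_kerP => u v uv.
  by rewrite !mxE !enum_rankK reach_sign_alternating.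
have rZ : \rank Z = #|bipartite_components G|.
  by apply/eqP; rewrite -[_ == _]/(row_free Z); apply/row_freeP; exists Q.
rewrite -[RHS]rZ; apply/eqP; rewrite eqn_leq; apply/andP; split; apply: mxrankS.
  apply/rV_subP => w; rewrite sub_kermx => /eqP/incidence_kerP w_alt.
  (* An alternating [w] is the combination of the rows of [Z] whose coefficients are its values at
     the roots. *)
  suff -> : w = (w *m Q) *m Z by apply: submxMl.
  apply/rowP => k; rewrite -(enum_valK k); move: (enum_val k) => v.
  rewrite mxE; under eq_bigr => i _ do rewrite mulQ !mxE enum_rankK.
  set C := [set u | connect (adjacent G) v u]%SET.
  have [C_bip|/(alternating_not_bipartite w_alt) wv] := pselect (bipartite_on G C).
    have C_in : C \in bipartite_components G.
      by rewrite inE; apply/andP; split; [apply/componentP; exists v|apply/asboolP].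
    pose i := enum_rank_in C_in C.
    have iv : connect (adjacent G) (r i) v.
      have := rP i; rewrite enum_rankK_in // => /setP/(_ v); rewrite !inE => <-.
      exact: connect0.
    rewrite (bigD1 i) //= -(alternating_reach_sign w_alt iv) big1 ?addr0 // => j ji.
    rewrite reach_sign_unconnected ?mulr0 //; apply: contra ji => jv.
    by apply/eqP/r_inj; apply: connect_trans jv _; rewrite sym.
  rewrite wv big1 // => j _.
  have [jv|/reach_sign_unconnected ->] := boolP (connect (adjacent G) (r j) v).
    by rewrite -(alternating_reach_sign w_alt jv) wv.
  by rewrite mulr0.
by apply/sub_kermxP.
Qed.

End IncidenceRank.

(** * Affine dimension from a linear parametrization *)

Lemma affine_dimE (R : realType) (vT : vectType R) (X : set vT) (x0 : vT) d
    (f : {linear 'rV[R]_d -> vT}) :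
  injective f -> X x0 -> (forall x, X x -> exists w, x = x0 + f w) ->
  (forall w, exists2 t : R, t != 0 & X (x0 + t *: f w)) ->
  affine_dim X = d%:Z.
Proof.
move=> f_inj Xx0 Xsub Xdir; rewrite /affine_dim.
suff -> : (\max_(k < (\dim {: vT}).+2 | `[< exists p : 'I_k -> vT,
    affinely_independent p /\ forall i, X (p i) >]) k)%N = d.+1.
  by rewrite -addn1 PoszD addrK.
apply/eqP; rewrite eqn_leq; apply/andP; split.
  (* Upper bound: the parameters of affinely independent points of [X] are affinely independent in a
     space of dimension d. *)
  apply/bigmax_leqP => k /asboolP[p [p_ind pX]].
  have [w pE] := choice (fun i => Xsub _ (pX i)).
  have {1}<- : \dim {: 'rV[R]_d} = d by rewrite dimvf /dim /= mul1n.
  apply: (affinely_independent_leq (p := w)) => a a0 aw0; apply: p_ind => //.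
  under eq_bigr => i _ do rewrite pE scalerDr -linearZ.
  by rewrite big_split /= -scaler_suml a0 scale0r add0r -linear_sum aw0 linear0.
(* Lower bound: take [x0] and one point of [X] along the image of each coordinate vector. The scales
   may differ; being nonzero suffices for independence. *)
have /choice[t tP] (i : 'I_d) : exists t : R, t != 0 /\ X (x0 + t *: f (delta_mx 0 i)).
  by have [t t0 Xt] := Xdir (delta_mx 0 i); exists t.
pose p (i : 'I_d.+1) := if unlift ord0 i is Some j
  then x0 + t j *: f (delta_mx 0 j) else x0.
have p_ind : affinely_independent p.
  move=> a a0 ap0.
  have fa0 : f (\row_j (a (lift ord0 j) * t j)) = 0.
    have E0 : \sum_i a i *: p i - (\sum_i a i) *: x0 = 0.
      by rewrite ap0 a0 scale0r subr0.
    rewrite -[RHS]E0 scaler_suml -sumrB big_ord_recl.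
    rewrite /p unlift_none subrr add0r [X in f X]row_sum_delta linear_sum /=.
    apply: eq_bigr => j _; rewrite liftK mxE linearZ scalerDr scalerA.
    by rewrite addrAC subrr add0r.
  have {}fa0 : \row_j (a (lift ord0 j) * t j) = 0 by apply: f_inj; rewrite fa0 linear0.
  have aS j : a (lift ord0 j) = 0.
    have := congr1 (fun w : 'rV_d => w 0 j) fa0; rewrite !mxE => /eqP.
    by rewrite mulf_eq0 (negPf ((tP j).1)) orbF => /eqP.
  move=> i; have [j ->|->] := unliftP ord0 i; first exact: aS.
  by move: a0; rewrite big_ord_recl big1 ?addr0.
have pX i : X (p i) by rewrite /p; case: unlift => [j|//]; apply: (tP j).2.
have d_lt : (d.+1 < (\dim {: vT}).+2)%N by rewrite ltnS; apply: affinely_independent_leq p_ind.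
apply: (leq_bigmax_cond (Ordinal d_lt)); apply/asboolP.
by exists p.
Qed.

(** * Feasible directions of the edge polytope *)

Section EdgePolytopeDimension.
Variables (R : realType) (V E : finType) (G : mgraph V E) (b : V -> R).
Local Notation RE := {ffun E -> R^o}.
Local Notation P := (edge_polytope G b).

Lemma suppP (X : set RE) e : reflect (exists2 x : RE, X x & x e <> 0) (e \in supp X).
Proof. by rewrite inE; apply: asboolP. Qed.

Lemma edge_polytope_interior : (exists x, P x) ->
  exists2 x, P x & forall e, e \in supp P -> 0 < x e :> R.
Proof.
move=> [y Py].
have /choice[f fP] (e : E) : exists x : RE, P x /\ (e \in supp P -> x e <> 0).
  have [/suppP[x Px xe]|_] := boolP (e \in supp P).
    by exists x.
  by exists y.
(* The average is over one point per edge together with [y], so it is over at least one point even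
   if [E] is empty. *)
pose c : R := #|E|.+1%:R^-1.
have c_gt0 : 0 < c by rewrite invr_gt0 ltr0n.
exists [ffun e => c * (y e + \sum_e' f e' e)].
  split=> [e|v].
    rewrite ffunE mulr_ge0 ?(ltW c_gt0) // addr_ge0 ?(Py.1) // sumr_ge0 // => e' _.
    exact: (fP e').1.1.
  under eq_bigr => e _ do rewrite ffunE.
  rewrite -mulr_sumr big_split /= exchange_big /= Py.2.
  under eq_bigr => e _ do rewrite (fP e).1.2.
  rewrite sumr_const -mulrS -mulr_natr mulrCA mulVf ?mulr1 //.
  by rewrite pnatr_eq0.
move=> e /(fP e).2 fe; rewrite ffunE mulr_gt0 // (bigD1 e) //=.
have fe_gt0 : 0 < f e e :> R by rewrite lt_def (fP e).1.1 andbT; apply/eqP.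
rewrite addrCA ltr_wpDr // addr_ge0 ?(Py.1) // sumr_ge0 // => e' _.
exact: (fP e').1.1.
Qed.

Lemma edge_polytope_dir (x u : RE) : P x ->
  (forall e, x e = 0 -> u e = 0) ->
  (forall v, \sum_(e in delta G v) (u e : R) = 0) ->
  exists2 t : R, t != 0 & P (x + t *: u).
Proof.
move=> [x_ge0 xb] u_supp u0.
have q_ge0 e : 0 <= `|u e : R| / x e by rewrite divr_ge0.
(* This scale s satisfies |u e| <= s * x e wherever x e > 0, so a step of length 1/s keeps all
   coordinates nonnegative. Terms with x e = 0 are 0, since 0 is its own inverse here; the summand 1
   keeps s nonzero. *)
have s_gt0 : 0 < 1 + \sum_e `|u e : R| / x e.
  by rewrite ltr_pwDl ?sumr_ge0.
exists (1 + \sum_e `|u e : R| / x e)^-1; first by rewrite invr_neq0 ?gt_eqF.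
set s := 1 + _ in s_gt0 *; split=> [e|v].
  rewrite !ffunE /=; have [xe|xe] := eqVneq (x e) 0.
    by rewrite u_supp ?scaler0 ?addr0.
  have xe_gt0 : 0 < x e :> R by rewrite lt_def xe x_ge0.
  rewrite -lerBlDl sub0r -[_ *: _]/(s^-1 * u e) lerNl -mulrN mulrC ler_pdivrMr //.
  apply: le_trans (_ : `|u e : R| <= _); first by rewrite -normrN ler_norm.
  rewrite mulrC -ler_pdivrMr // /s (bigD1 e) //=.
  by rewrite addrCA lerDl addr_ge0 // sumr_ge0.
under eq_bigr => e _ do rewrite !ffunE -[_ *: _]/(s^-1 * u e).
by rewrite big_split /= -mulr_sumr u0 mulr0 addr0 xb.
Qed.

Local Notation H := (gr G P).
Local Notation T := {e : E | e \in supp P}.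

(** [kermx] is a left kernel, so the transpose turns the vertex equations on edge vectors into row
    form. *)
Lemma edge_polytope_dim : (exists x, P x) ->
  affine_dim P = (\rank (kermx (incidence R H)^T))%:Z.
Proof.
move=> /edge_polytope_interior[x0 Px0 x0_gt0].
set A := incidence R H; set K := kermx A^T; set B := row_base K.
(* Extension by zero from the edges of the support to all of [E]. *)
pose J : 'M[R]_(#|{: T}|, #|E|) :=
  \matrix_(i, j) (val (enum_val i : T) == enum_val j)%:R.
have JE (y : 'rV[R]_#|{: T}|) e :
    (y *m J) 0 (enum_rank e) = if insub e is Some t then y 0 (enum_rank (t : T)) else 0.
  rewrite mxE; case: insubP => [t eS tE|eS].
    rewrite (bigD1 (enum_rank t)) //= mxE !enum_rankK tE eqxx mulr1 big1 ?addr0 // => i it.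
    rewrite mxE enum_rankK -tE (inj_eq val_inj) -(inj_eq enum_rank_inj) enum_valK.
    by rewrite (negPf it) mulr0.
  rewrite big1 // => i _; rewrite mxE enum_rankK; case: eqP => [ie|_]; last by rewrite mulr0.
  by move: eS; rewrite -ie (valP (enum_val i : T)).
have J_inj : injective (mulmxr J : 'rV_#|{: T}| -> _).
  move=> y z /= yz; apply/rowP => i; rewrite -(enum_valK i).
  by have := congr1 (fun w : 'rV_#|E| => w 0 (enum_rank (val (enum_val i : T)))) yz;
     rewrite !JE valK.
have JA (y : 'rV[R]_#|{: T}|) v :
    \sum_(e in delta G v) (y *m J) 0 (enum_rank e) = (y *m A^T) 0 (enum_rank v).
  rewrite [RHS]mxE; under eq_bigr => e _ do rewrite mxE.
  rewrite exchange_big /=; apply: eq_bigr => i _; rewrite -mulr_sumr; congr (_ * _).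
  under eq_bigr => e _ do rewrite mxE enum_rankK.
  rewrite !mxE enum_rankK /=; set e := val (enum_val i : T).
  have [ve|ve] := boolP (v \in ends G e).
    rewrite (bigD1 e) ?inE //= eqxx big1 ?addr0 // => e' /andP[_ /negPf].
    by rewrite eq_sym => ->.
  rewrite big1 // => e' ve'; case: eqP => // ee'.
  by move: ve' ve; rewrite inE -ee' => ->.
(* Coordinates in a basis of the kernel parametrize the directions. *)
pose f (w : 'rV[R]_(\rank K)) : RE := [ffun e => (w *m B *m J) 0 (enum_rank e)].
have f_lin : linear f.
  by move=> a w w'; apply/ffunP => e; rewrite !ffunE !mulmxDl -!scalemxAl !mxE.
pose fL : {linear 'rV[R]_(\rank K) -> RE} :=
  HB.pack f (GRing.isLinear.Build _ _ _ _ f f_lin).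
have fE w e : fL w e = (w *m B *m J) 0 (enum_rank e).
  by rewrite -[fL w]/(f w) ffunE.
apply: (@affine_dimE _ _ P x0 _ fL) => //.
- move=> w w' /ffunP fw; apply: (row_free_inj (row_base_free K)).
  apply: J_inj; apply/rowP => i; have := fw (enum_val i).
  by rewrite !fE enum_valK.
(* Off the support [x] and [x0] both vanish, and they satisfy the same vertex equations, so their
   difference comes from the kernel. *)
- move=> x Px; pose y : 'rV[R]_#|{: T}| := \row_i (x - x0) (val (enum_val i : T)).
  have yJ e : (y *m J) 0 (enum_rank e) = (x - x0) e.
    rewrite JE; case: insubP => [t eS tE|eS]; first by rewrite mxE enum_rankK tE.
    have x0e z : P z -> z e = 0.
      by move=> Pz; apply: contrapT => ze; move/suppP: eS; apply; exists z.
    by rewrite !ffunE !x0e // oppr0 addr0.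
  have yK : (y <= B)%MS.
    rewrite eq_row_base; apply/sub_kermxP/rowP => i.
    rewrite -(enum_valK i) -JA mxE; under eq_bigr => e _ do rewrite yJ !ffunE.
    by rewrite sumrB Px.2 Px0.2 subrr.
  have [w yE] := submxP yK; exists w; apply/ffunP => e.
  by rewrite ffunE fE -yE yJ !ffunE addrCA subrr addr0.
move=> w; apply: edge_polytope_dir => // [e x0e|v].
  rewrite fE JE; case: insubP => // t eS _.
  by have := x0_gt0 _ eS; rewrite x0e ltxx.
under eq_bigr => e _ do rewrite fE.
rewrite JA; suff -> : w *m B *m A^T = 0 by rewrite mxE.
apply/sub_kermxP; apply: submx_trans (submxMl _ _) _; by rewrite eq_row_base.
Qed.

End EdgePolytopeDimension.

Theorem corollary18 (R : realType) (V E : finType) (G : mgraph V E)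
    (b : V -> R) (V_neq0 : (0 < #|V|)%N) (b_ge0 : forall v : V, 0 <= b v)
    (P_neq0 : exists x : {ffun E -> R^o}, edge_polytope G b x) :
  affine_dim (edge_polytope G b) =
    #|supp (edge_polytope G b)|%:Z - #|V|%:Z
      + #|bipartite_components (gr G (edge_polytope G b))|%:Z.
Proof.
(* Both nullities are now written through the rank r of A, as |S| - r and |V| - r; the bounds on r
   turn these natural subtractions into integer ones. *)
rewrite edge_polytope_dim // -(rank_ker_incidence R) !mxrank_ker mxrank_tr.
set A := incidence R _; move: (\rank A) (rank_leq_row A) (rank_leq_col A) => r rV.
by rewrite card_sig => rS; rewrite -!subzn // addrA subrK.
Qed.
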